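(* Let $K$ be a nonempty compact Hausdorff space without isolated points and let $X=C(K)$ be the space of real-valued continuous functions on $K$ with the supremum norm. Then for every $\varepsilon>0$ and every $n\in\mathbb{N}$, $n\ge 1$, $$\mathrm{Daug}_n(X,\varepsilon)\le \frac{2}{n}.$$ Hence $D_X(\varepsilon)$ is of order $\varepsilon^{-1}$, i.e. there are constants $0<c\le C<\infty$ such that $c\,\varepsilon^{-1}\le D_X(\varepsilon)\le C\,\varepsilon^{-1}$ for all sufficiently small $\varepsilon>0$.
   Context: $S(X)$ is the unit sphere of the real Banach space $X$. For $x\in S(X)$ and $\varepsilon>0$ put $l^+(x,\varepsilon)=\{y\in X: \|y\|\le 1+\varepsilon,\ \|x+y\|>2-\varepsilon\}$. For $A\subset X$, $\mathrm{conv}_n(A)$ is the set of all convex combinations of $n$-point collections of elements of $A$. Define $\mathrm{Daug}_n(X,\varepsilon)=\sup_{x,y\in S(X)}\mathrm{dist}\bigl(y,\mathrm{conv}_n(l^+(x,\varepsilon))\bigr)$ and $D_X(\varepsilon)=\inf\{n\in\mathbb{N}: \mathrm{conv}_n(l^+(x,\varepsilon))\supset S(X)\ \text{for all } x\in S(X)\}$. *)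

(* Defs.v *)
From HB Require Import structures.
From mathcomp Require Import all_boot all_order all_algebra.
From mathcomp Require Import all_classical all_reals all_analysis.

Set Implicit Arguments.
Unset Strict Implicit.
Unset Printing Implicit Defensive.

Import Order.TTheory GRing.Theory Num.Theory.
Import numFieldNormedType.Exports.

Local Open Scope classical_set_scope.
Local Open Scope ring_scope.

(* [Cfun cK] is [continuousType K R] under a new name: the library already puts
   a non-normed topology on [continuousType K R], and the sup norm is a norm
   only because [K] is compact, whence the parameter [cK]. *)
Definition Cfun (R : realType) (K : topologicalType)
  (cK : compact [set: K]) : Type := continuousType K R.

Section Cfun_theory.
Context {R : realType} {K : topologicalType} {cK : compact [set: K]}.
Local Notation C := (Cfun R cK).
Implicit Types f g : C.

HB.instance Definition _ := Choice.on C.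

Lemma Cfun_continuous f : continuous (f : K -> R).
Proof. exact: cts_fun. Qed.

Lemma CfunP f g : (forall x, f x = g x) -> f = g.
Proof. by move=> fg; apply/continuousEP. Qed.

Let cst_cts (a : R) : continuous (fun _ : K => a).
Proof. by move=> x; exact: cvg_cst. Qed.

Let add_cts f g : continuous (fun x => f x + g x).
Proof.
by move=> x; apply: (@continuousD R R^o); exact: Cfun_continuous.
Qed.

Let opp_cts f : continuous (fun x => - f x).
Proof. by move=> x; apply: (@continuousN R R^o); exact: Cfun_continuous. Qed.

Let scale_cts (a : R) f : continuous (fun x => a * f x).
Proof.
by move=> x; apply: continuousM; [exact: cst_cts|exact: Cfun_continuous].
Qed.

Definition Cfun0 : C := mkcts (@cst_cts 0).
Definition Cfun_add f g : C := mkcts (@add_cts f g).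
Definition Cfun_opp f : C := mkcts (@opp_cts f).
Definition Cfun_scale (a : R) f : C := mkcts (@scale_cts a f).

Let addA : associative Cfun_add.
Proof. by move=> f g h; apply: CfunP => x; exact: addrA. Qed.
Let addC : commutative Cfun_add.
Proof. by move=> f g; apply: CfunP => x; exact: addrC. Qed.
Let add0 : left_id Cfun0 Cfun_add.
Proof. by move=> f; apply: CfunP => x; exact: add0r. Qed.
Let addN : left_inverse Cfun0 Cfun_opp Cfun_add.
Proof. by move=> f; apply: CfunP => x; exact: addNr. Qed.

HB.instance Definition _ := GRing.isZmodule.Build C addA addC add0 addN.

Let scaleA (a b : R) f : Cfun_scale a (Cfun_scale b f) = Cfun_scale (a * b) f.
Proof. by apply: CfunP => x; exact: mulrA. Qed.
Let scale1 : left_id 1 Cfun_scale.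
Proof. by move=> f; apply: CfunP => x; exact: mul1r. Qed.
Let scaleDr : right_distributive Cfun_scale +%R.
Proof. by move=> a f g; apply: CfunP => x; exact: mulrDr. Qed.
Let scaleDl f : {morph Cfun_scale^~ f : a b / a + b}.
Proof. by move=> a b; apply: CfunP => x; exact: mulrDl. Qed.

HB.instance Definition _ :=
  GRing.Zmodule_isLmodule.Build R C scaleA scale1 scaleDr scaleDl.

Definition Cfun_norm f : R := sup (range (fun x => `|f x|)).

Lemma Cfun_has_ubound f : has_ubound (range (fun x => `|f x|)).
Proof.
have /compact_bounded[M [_ MP]] : compact ((f : K -> R^o) @` [set: K]).
  apply: continuous_compact cK.
  by apply: continuous_subspaceT; exact: Cfun_continuous.
exists (M + 1) => _ [x _ <-]; apply: (MP (M + 1)); first by rewrite ltrDl.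
by exists x.
Qed.

Lemma Cfun_norm_ub f x : `|f x| <= Cfun_norm f.
Proof. by apply: ub_le_sup; [exact: Cfun_has_ubound|exists x]. Qed.

Lemma Cfun_norm_ge0 f : 0 <= Cfun_norm f.
Proof.
have [K0|/set0P[_ [x _ _]]] := eqVneq (range (fun x => `|f x|)) set0.
  by rewrite /Cfun_norm K0 sup0.
exact: le_trans (normr_ge0 (f x)) (Cfun_norm_ub f x).
Qed.

Lemma Cfun_norm_le f (r : R) :
  0 <= r -> (forall x, `|f x| <= r) -> Cfun_norm f <= r.
Proof.
move=> r0 fr; have [K0|/set0P K0] := eqVneq (range (fun x => `|f x|)) set0.
  by rewrite /Cfun_norm K0 sup0.
by apply: ge_sup => // _ [x _ <-].
Qed.

Let norm_triangle f g : Cfun_norm (f + g) <= Cfun_norm f + Cfun_norm g.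
Proof.
apply: Cfun_norm_le => [|x]; first by rewrite addr_ge0 ?Cfun_norm_ge0.
by rewrite (le_trans (ler_normD _ _)) ?lerD ?Cfun_norm_ub.
Qed.

Let norm_scale_le (a : R) f : Cfun_norm (a *: f) <= `|a| * Cfun_norm f.
Proof.
apply: Cfun_norm_le => [|x]; first by rewrite mulr_ge0 ?Cfun_norm_ge0.
by rewrite [leLHS]normrM ler_wpM2l ?Cfun_norm_ub.
Qed.

Let norm_scale (a : R) f : Cfun_norm (a *: f) = `|a| * Cfun_norm f.
Proof.
apply/eqP; rewrite eq_le norm_scale_le/=.
have [->|a0] := eqVneq a 0; first by rewrite normr0 mul0r Cfun_norm_ge0.
rewrite -ler_pdivlMl ?normr_gt0// -normfV.
by rewrite -[leLHS](_ : Cfun_norm (a^-1 *: (a *: f)) = _) ?norm_scale_le//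
  scalerA mulVf// scale1r.
Qed.

Let norm_eq0 f : Cfun_norm f = 0 -> f = 0.
Proof.
move=> f0; apply: CfunP => x; apply/eqP; rewrite -normr_le0 -f0.
exact: Cfun_norm_ub.
Qed.

HB.instance Definition _ :=
  Lmodule_isNormed.Build R C norm_triangle norm_scale norm_eq0.

Lemma Cfun_normE f : `|f| = sup (range (fun x => `|f x|)).
Proof. by []. Qed.

Lemma CfunD f g x : (f + g) x = f x + g x.
Proof. by []. Qed.

Lemma CfunN f x : (- f) x = - f x.
Proof. by []. Qed.

Lemma CfunZ (a : R) f x : (a *: f) x = a * f x.
Proof. by []. Qed.

End Cfun_theory.

Section Daug.
Context {R : realType} (X : normedModType R).

Definition unit_sphere : set X := [set x | `|x| = 1].

Definition lplus (x : X) (eps : R) : set X :=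
  [set y | `|y| <= 1 + eps /\ `|x + y| > 2 - eps].

Definition conv_n (n : nat) (A : set X) : set X :=
  [set z | exists (a : 'I_n -> X) (w : 'I_n -> R),
    [/\ forall i, A (a i), forall i, 0 <= w i, \sum_(i < n) w i = 1
      & z = \sum_(i < n) w i *: a i]].

Definition Daug (n : nat) (eps : R) : \bar R :=
  ereal_sup [set edist_inf (conv_n n (lplus x eps)) y
            | x in unit_sphere & y in unit_sphere].

(* The infimum is taken in the extended reals, so that it is +oo when no [n]
   qualifies. *)
Definition D_index (eps : R) : \bar R :=
  ereal_inf [set n%:R%:E | n in [set n : nat |
    forall x, unit_sphere x -> unit_sphere `<=` conv_n n (lplus x eps)]].

End Daug.

(* Main.v *)
Require Import Defs.
From HB Require Import structures.
From mathcomp Require Import all_boot all_order all_algebra.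
From mathcomp Require Import all_classical all_reals all_analysis.
From mathcomp Require Import ring lra.

Import Order.TTheory GRing.Theory Num.Theory.
Import numFieldNormedType.Exports.

Local Open Scope classical_set_scope.
Local Open Scope ring_scope.

(** Upper bound. Let [f], [g] be in the unit sphere. Up to a sign [s], the
    function [f] is close to its norm [1] on a nonempty open set [U]. As [K]
    has no isolated points, [U] has room for [n] bumps [phi i] with disjoint
    supports, each equal to [1] somewhere. Interpolating between [g] and the
    constant [s] by [phi i] gives a function [a i] which takes values between
    [-1] and [1] but equals [s] at a point of [U], so that [a i] belongs to
    [l^+(f, eps)]. The [a i] differ from [g], by at most [2], on disjoint
    sets, hence their average is within [2 / n] of [g] ([exists_bumps],
    [slice_approximation]). This bounds [Daug_n] by [2 / n]. When [n >= 4 /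
    eps] the error in this average is at most [eps / 2]; adding it to each [a
    i] makes the average equal to [g] without leaving [l^+(f, eps)], and so
    [D(eps) <= 5 / eps] for [eps <= 1] ([sphere_sub_conv_n]).

    Lower bound. If [-1] is a convex combination of elements of [l^+(1, eps)]
    and [eps < 1], each of these elements exceeds [1 - eps] at some point,
    while all the others are at most [1 + eps] in absolute value there.
    Evaluating at that point shows that every weight is at most [eps / 2],
    hence that there are at least [2 / eps] of them ([conv_n_opp_one_size]).
    *)

(** * Continuous functions on a compact space *)

Definition Cfun_mul {R : realType} {K : topologicalType}
    {cK : compact [set: K]} (f g : Cfun R cK) : Cfun R cK :=
  mkcts (fun x => continuousM (@Cfun_continuous R K cK f x)
                              (@Cfun_continuous R K cK g x)).

Definition Cfun_cst {R : realType} {K : topologicalType}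
    (cK : compact [set: K]) (c : R) : Cfun R cK :=
  mkcts (@cst_continuous K R c).

Lemma Cfun_sum {R : realType} {K : topologicalType} {cK : compact [set: K]}
    (n : nat) (a : 'I_n -> Cfun R cK) (x : K) :
  (\sum_(i < n) a i) x = \sum_(i < n) a i x.
Proof. by elim/big_ind2: _ => // _ u _ v <- <-; rewrite CfunD. Qed.

Lemma Cfun_norm_gt {R : realType} {K : topologicalType} {cK : compact [set: K]}
    (f : Cfun R cK) (r : R) :
  [set: K] !=set0 -> r < `|f| -> exists x, r < `|f x|.
Proof.
move=> [x0 _] /sup_gt[|_ [x _ <-] rf]; last by exists x.
by exists `|f x0|, x0.
Qed.

Lemma Cfun_norm_cst {R : realType} {K : topologicalType}
    (cK : compact [set: K]) (c : R) :
  [set: K] !=set0 -> `|Cfun_cst cK c| = `|c|.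
Proof.
move=> [x0 _]; apply/eqP; rewrite eq_le; apply/andP; split.
  exact: Cfun_norm_le.
exact: (Cfun_norm_ub (Cfun_cst cK c) x0).
Qed.

(** * Bumps with disjoint supports *)

Lemma exists_bump {R : realType} {K : topologicalType}
    (cK : compact [set: K]) (hK : hausdorff_space K) (U : set K) (x : K) :
  open U -> U x -> exists phi : Cfun R cK,
    [/\ forall y, 0 <= phi y <= 1, forall y, ~ U y -> phi y = 0 & phi x = 1].
Proof.
move=> oU Ux.
have /(@normal_separatorP R) sepK := compact_normal hK cK.
have cx : closed [set x] by exact/accessible_closed_set1/hausdorff_accessible.
have Ux0 : ~` U `&` [set x] = set0.
  by rewrite -subset0 => y [nUy /= yx]; apply: nUy; rewrite yx.
have /(@uniform_separatorP _ R)[phi [cphi phi01 phi0 phi1]] :=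
  sepK _ _ (open_closedC oU) cx Ux0.
exists (mkcts cphi); split => [y|y nUy|].
- have /(_ (phi y)) := phi01; rewrite /= in_itv/=; apply; by exists y.
- by apply: phi0; exists y.
- by apply: phi1; exists x.
Qed.

(** The disjointness of the supports is recorded as [\sum_i phi i <= 1], the
    only consequence of it that matters for averages.  In the induction, two
    points of [U] are separated by disjoint open sets; one receives a new bump
    and the other all the previous ones, so that at each point the sum reduces
    either to the new bump or to the previous sum. *)
Lemma exists_bumps {R : realType} {K : topologicalType}
    (cK : compact [set: K]) (hK : hausdorff_space K)
    (K_no_isolated : isolated [set: K] = set0) (n : nat) (U : set K) :
  open U -> U !=set0 -> exists phi : 'I_n -> Cfun R cK,
    [/\ forall i x, 0 <= phi i x <= 1,
        forall i x, ~ U x -> phi i x = 0,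
        forall i, exists2 x, U x & phi i x = 1
      & forall x, \sum_(i < n) phi i x <= 1].
Proof.
have /perfectTP_ex two_points : perfect_set [set: K].
  by apply/perfectP; split => //; exact: closedT.
elim: n U => [|n IHn] U oU U0.
  by exists (fun=> 0); split => [[]//|[]//|[]//|x]; rewrite big_ord0.
have [p [q [Up Uq pq]]] := two_points U oU U0.
move: (hK); rewrite open_hausdorff => /(_ p q pq)[[V W] /= []].
rewrite !inE => Vp Wq [oV oW VW0].
have [psi [psi01 psi0 psi1 psi_sum]] :=
  IHn _ (openI oU oW) (ex_intro _ q (conj Uq Wq)).
have [phi [phi01 phi0 phi1]] :=
  @exists_bump R K cK hK _ p (openI oU oV) (conj Up Vp).
exists (fun i => oapp psi phi (unlift ord0 i)); split => [i x|i x nUx|i|x].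
- by case: unliftP => [j|] _ /=.
- by case: unliftP => [j|] _ /=; [apply: psi0|apply: phi0] => -[].
- case: unliftP => [j|] _ /=; last by exists p.
  by have [x [Ux _] psix] := psi1 j; exists x.
- rewrite big_ord_recl unlift_none /=.
  under eq_bigr do rewrite liftK /=.
  have [Vx|nVx] := pselect (V x); last by rewrite phi0 ?add0r// => -[].
  rewrite big1 ?addr0 => [|i _]; first by case/andP: (phi01 x).
  by apply: psi0 => -[_ Wx]; rewrite -[False]/(set0 x) -VW0.
Qed.

(** * Approximation by averages of slice elements *)

(** The constant [s] is the sign of [f] at a point where [f] almost attains its
    norm, and the bumps live where [s * f] is still larger than [1 - eps]. *)
Lemma slice_approximation {R : realType} {K : topologicalType}
    (K_nonempty : [set: K] !=set0) (cK : compact [set: K])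
    (hK : hausdorff_space K) (K_no_isolated : isolated [set: K] = set0)
    (f g : Cfun R cK) (eps : R) (n : nat) :
  `|f| = 1 -> `|g| = 1 -> 0 < eps -> (0 < n)%N ->
  exists a : 'I_n -> Cfun R cK,
    (forall i, `|a i| <= 1 /\ 2 - eps < `|f + a i|) /\
    `|g - \sum_(i < n) n%:R^-1 *: a i| <= 2 / n%:R.
Proof.
move=> f1 g1 eps0 n0.
have [x0 fx0] : exists x, 1 - eps < `|f x|.
  by apply: Cfun_norm_gt => //; rewrite f1 gtrBl.
pose s : R := (-1) ^+ (f x0 < 0)%R.
have s1 : `|s| = 1 by rewrite normr_sign.
have ss : s * s = 1 by rewrite -expr2 sqrr_sign.
pose U := [set x | 1 - eps < (s *: f) x].
have oU : open U.
  have -> : U = (s *: f : K -> R) @^-1` [set r | 1 - eps < r] by [].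
  by apply: open_comp; [move=> x _; exact: Cfun_continuous|exact: open_gt].
have U0 : U !=set0 by exists x0; rewrite /U /= CfunZ /s -normrEsign.
have [phi [phi01 _ phi1 phi_sum]] :=
  @exists_bumps R K cK hK K_no_isolated n U oU U0.
pose a i : Cfun R cK := g + Cfun_mul (phi i) (Cfun_cst cK s - g).
have aE i x : a i x = g x + phi i x * (s - g x) by [].
have gb x : `|g x| <= 1 by rewrite -g1; exact: Cfun_norm_ub.
have sgb x : `|s - g x| <= 2.
  by rewrite (le_trans (ler_normB _ _))// s1; have := gb x; lra.
exists a; split => [i|].
  split.
    apply: Cfun_norm_le => // x; rewrite aE.
    have -> : g x + phi i x * (s - g x) = (1 - phi i x) * g x + phi i x * s.
      by ring.
    have /andP[p0 p1] := phi01 i x.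
    rewrite (le_trans (ler_normD _ _))// !normrM s1 mulr1.
    rewrite (ger0_norm p0) ger0_norm ?subr_ge0//.
    have : (1 - phi i x) * `|g x| <= 1 - phi i x.
      by rewrite ler_piMr ?subr_ge0.
    lra.
  have [x Ux phix] := phi1 i.
  apply: lt_le_trans (Cfun_norm_ub (f + a i) x).
  rewrite CfunD aE phix mul1r subrKC -[ltRHS]mul1r -s1 -normrM mulrDr ss.
  apply: lt_le_trans (ler_norm _).
  by move: Ux; rewrite /U /= CfunZ; lra.
apply: Cfun_norm_le => [|x]; first by rewrite divr_ge0.
have nz : n%:R != 0 :> R by rewrite pnatr_eq0 -lt0n.
have -> : (g - \sum_(i < n) n%:R^-1 *: a i) x =
    - (n%:R^-1 * ((\sum_(i < n) phi i x) * (s - g x))).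
  rewrite CfunD CfunN Cfun_sum.
  under eq_bigr do rewrite CfunZ aE.
  rewrite -mulr_sumr big_split/= sumr_const card_ord -mulr_suml -mulr_natr.
  by field.
have S0 : 0 <= \sum_(i < n) phi i x.
  by apply: sumr_ge0 => i _; case/andP: (phi01 i x).
rewrite normrN !normrM normfV normr_nat mulrC ler_wpM2r ?invr_ge0//.
by rewrite (ger0_norm S0) -[leRHS]mul1r ler_pM.
Qed.

(** Each element of the average is shifted by the error of the average.  The
    slice for [eps / 2] leaves room for a shift of norm at most [eps / 2]. *)
Lemma sphere_sub_conv_n {R : realType} {K : topologicalType}
    (K_nonempty : [set: K] !=set0) (cK : compact [set: K])
    (hK : hausdorff_space K) (K_no_isolated : isolated [set: K] = set0)
    (f : Cfun R cK) (eps : R) (n : nat) :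
  unit_sphere f -> 0 < eps -> 4 / eps <= n%:R ->
  @unit_sphere R (Cfun R cK) `<=` conv_n n (lplus f eps).
Proof.
move=> f1 eps0 epsn g g1.
have n0 : 0 < n%:R :> R by rewrite (lt_le_trans _ epsn)// divr_gt0.
have e20 : 0 < eps / 2 by rewrite divr_gt0.
have [|a [a_slice a_avg]] :=
  @slice_approximation R K K_nonempty cK hK K_no_isolated f g (eps / 2) n
    f1 g1 e20.
  by rewrite -(ltr0n R).
set r := g - _ in a_avg.
have rb : `|r| <= eps / 2.
  rewrite (le_trans a_avg)// ler_pdivrMr//.
  by move: epsn; rewrite ler_pdivrMr//; lra.
have sum_w : \sum_(i < n) (n%:R^-1 : R) = 1.
  by rewrite sumr_const card_ord -[LHS]mulr_natr mulVf// gt_eqF.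
exists (fun i => a i + r), (fun=> n%:R^-1); split => //.
- move=> i; have [ai1 fai] := a_slice i; split.
    by rewrite (le_trans (ler_normD _ _))//; lra.
  have := ler_normB (f + (a i + r)) r.
  by rewrite addrA addrK; lra.
- under eq_bigr do rewrite scalerDr.
  by rewrite big_split/= -scaler_suml sum_w scale1r subrKC.
Qed.

(** * The lower bound *)

Lemma conv_n_opp_one_size {R : realType} {K : topologicalType}
    (K_nonempty : [set: K] !=set0) (cK : compact [set: K])
    (eps : R) (n : nat) : 0 < eps -> eps < 1 ->
  conv_n n (lplus (Cfun_cst cK 1) eps) (Cfun_cst cK (-1)) ->
  2 / eps <= n%:R.
Proof.
move=> eps0 eps1 [a [w [a_slice w0 w1 aw]]].
have abs_a j x : `|a j x| <= 1 + eps.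
  by have [aj _] := a_slice j; exact: le_trans (Cfun_norm_ub _ _) aj.
have wb i : w i <= eps / 2.
  have [_ /(Cfun_norm_gt _ _ K_nonempty)[x]] := a_slice i.
  rewrite CfunD -[Cfun_cst cK 1 x]/1 => ax.
  have aix : 1 - eps < a i x.
    have := abs_a i x; rewrite ler_norml => /andP[ax_lo ax_hi].
    by move: ax; rewrite ltr_normr => /orP[|] ax; lra.
  have : -1 = \sum_(j < n) w j * a j x.
    by rewrite -[LHS]/(Cfun_cst cK (-1) x) aw Cfun_sum.
  move: w1; rewrite (bigD1 i)//= [in X in _ -> X -> _](bigD1 i)//= => w1 ax1.
  have : (\sum_(j < n | j != i) w j) * (- (1 + eps)) <=
         \sum_(j < n | j != i) w j * a j x.
    rewrite mulr_suml ler_sum// => j _; rewrite ler_wpM2l//.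
    by have := abs_a j x; rewrite ler_norml => /andP[].
  have : w i * (1 - eps) <= w i * a i x by rewrite ler_wpM2l// ltW.
  have -> : \sum_(j < n | j != i) w j = 1 - w i by lra.
  by lra.
have : \sum_(i < n) w i <= \sum_(i < n) eps / 2 by exact: ler_sum.
by rewrite w1 sumr_const card_ord -mulr_natr ler_pdivrMr//; lra.
Qed.

(** * The Daugavet constants of [C(K)] *)

Theorem lemma6p7 (R : realType) (K : topologicalType)
  (K_nonempty : [set: K] !=set0) (cK : compact [set: K])
  (hK : hausdorff_space K) (K_no_isolated : isolated [set: K] = set0) :
  (forall (eps : R) (n : nat), 0 < eps -> (1 <= n)%N ->
     (Daug (Cfun R cK) n eps <= (2 / n%:R)%:E)%E) /\
  (exists c C : R, [/\ 0 < c, c <= C &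
     \forall eps \near 0^'+,
       ((c * eps^-1)%:E <= D_index (Cfun R cK) eps)%E /\
       (D_index (Cfun R cK) eps <= (C * eps^-1)%:E)%E]).
Proof.
split.
  move=> eps n eps0 n0; apply: ge_ereal_sup => _ [f f1 [g g1 <-]].
  have [a [a_slice a_avg]] :=
    @slice_approximation R K K_nonempty cK hK K_no_isolated f g eps n
      f1 g1 eps0 n0.
  (* The balls defining the distance are open: the bound is reached only up to
     an arbitrary [e > 0]. *)
  apply/lee_addgt0Pr => e e0.
  apply: ge_ereal_inf; exists (edist (g, \sum_(i < n) n%:R^-1 *: a i)).
    exists (\sum_(i < n) n%:R^-1 *: a i) => //.
    exists a, (fun=> n%:R^-1); split => //.
    - move=> i; have [ai1 fai] := a_slice i; split=> //.
      by rewrite (le_trans ai1)// lerDl ltW.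
    - by rewrite sumr_const card_ord -[LHS]mulr_natr mulVf// pnatr_eq0 -lt0n.
  rewrite -EFinD; apply: edist_fin => /=.
    by rewrite ltr_wpDl// divr_ge0.
  by rewrite -ball_normE /ball_ /= (le_lt_trans a_avg)// ltrDl.
exists 2, 5; split => //.
  by rewrite ler_nat.
near=> eps.
have eps0 : 0 < eps by near: eps; exact: nbhs_right_gt.
have eps1 : eps < 1 by near: eps; exact: nbhs_right_lt.
split.
  apply: le_ereal_inf_tmp => _ [n conv_sphere <-]; rewrite lee_fin.
  apply: (@conv_n_opp_one_size R K K_nonempty cK) => //.
  by apply: conv_sphere; rewrite /unit_sphere /= Cfun_norm_cst ?normrN ?normr1.
pose n := (Num.trunc (4 / eps)).+1.
have eps4 : 0 <= 4 / eps by rewrite divr_ge0// ltW.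
apply: ge_ereal_inf; exists n%:R%:E.
  exists n => // f f1; apply: sphere_sub_conv_n => //.
  by rewrite ltW// truncnS_gt.
rewrite lee_fin /n -natr1.
have : (Num.trunc (4 / eps))%:R <= 4 / eps by rewrite truncn_le.
(* [4 / eps + 1 <= 5 / eps] since [eps < 1] *)
have : 1 <= eps^-1 by rewrite invf_ge1// ltW.
by lra.
Unshelve. all: by end_near.
Qed.
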